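(* For all positive integers $n,r$ and every positive integer $k\le r$, $$p(n,r)\le p'\left(\left\lceil\frac{n}{r-k+1}\right\rceil k,\ k\right).$$ In particular, there exists an absolute constant $c>0$ such that if $n<r^2$ then $$p(n,r)\le c\left(\frac{n}{r}\right)^2\ln\frac{n}{r}\cdot e^{\frac{n}{r}} .$$
   Context: A hypergraph is a pair $(V,E)$ where $V$ is a finite set (of vertices) and $E$ is a family of subsets of $V$ (edges). It is $n$-uniform if every edge has size $n$. A vertex $r$-coloring is a map $V\to\{1,\dots,r\}$; it is called panchromatic if every edge contains a vertex of every one of the $r$ colors. $p(n,r)$ denotes the minimal number of edges of an $n$-uniform hypergraph that has no panchromatic $r$-coloring. $p'(n,r)$ denotes the minimal number of edges of an $n$-uniform hypergraph $H=(V,E)$ (over all finite vertex sets $V$) such that every subset $V'\subset V$ with $|V'|\ge\left\lceil\frac{r-1}{r}|V|\right\rceil$ contains an edge of $H$ (as a subset). A minimum over an empty set of hypergraphs is understood as $+\infty$ (this only matters in the degenerate case of one color).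
   Formalization: The second bound fails for n near or below r (for n=r=2 its right side is 0 but p(2,2)=3); it is proved as stated for 2r ≤ n < r², and for n < 2r (still n < r²) it is replaced by p(n,r) ≤ c with the same absolute constant c. *)

(* Defs.v *)
From mathcomp Require Import all_boot all_order all_algebra.
From mathcomp Require Import classical_sets reals constructive_ereal ereal.
From mathcomp Require Import sequences exp.

Set Implicit Arguments.
Unset Strict Implicit.
Unset Printing Implicit Defensive.

Import Order.TTheory GRing.Theory Num.Theory.

Definition ceil_div (m d : nat) : nat := (m + d.-1) %/ d.

Lemma ceil_div_leq (m d q : nat) :
  0 < d -> (ceil_div m d <= q) = (m <= q * d).
Proof.
case: d => // d _; rewrite /ceil_div /= -ltnS ltn_divLR // mulSn.
by rewrite addnC -addSn leq_add2l.
Qed.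

Section Hypergraphs.
Variable V : finType.
Implicit Type E : {set {set V}}.

Definition uniform (n : nat) E : Prop := forall e, e \in E -> #|e| = n.

Definition panchromatic (r : nat) E (f : V -> 'I_r) : Prop :=
  forall e, e \in E -> forall c : 'I_r, exists2 v, v \in e & f v = c.

Definition large_sets_contain_edge (r : nat) E : Prop :=
  forall W : {set V}, ceil_div ((r - 1) * #|V|) r <= #|W| ->
    exists2 e, e \in E & e \subset W.

End Hypergraphs.

(* The infima below range over sets of natural numbers embedded in \bar R, so
   they are minima when the set is nonempty, and +oo when it is empty. *)

Definition p_min (R : realType) (n r : nat) : \bar R :=
  ereal_inf [set x | exists (V : finType) (E : {set {set V}}),
    [/\ uniform n E, ~ (exists f : V -> 'I_r, panchromatic E f)
      & x = (#|E|%:R)%:E]]%classic.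

Definition p'_min (R : realType) (n r : nat) : \bar R :=
  ereal_inf [set x | exists (V : finType) (E : {set {set V}}),
    [/\ uniform n E, large_sets_contain_edge r E & x = (#|E|%:R)%:E]]%classic.

(* Main.v *)
Require Import Defs.
From mathcomp Require Import all_boot all_order all_algebra.
From mathcomp Require Import classical_sets reals constructive_ereal ereal.
From mathcomp Require Import sequences exp.
From mathcomp Require Import fintype finset ring lra zify.

(** The two quantities are compared by a blow-up.  Replace each vertex of an
    [N]-uniform hypergraph [(V, E)] by [b = r %/ k] copies.  In an [r]-coloring
    of the [|V| * b] copies, the sets of vertices of [V] whose copies show a
    given color have total size at most [|V| * b], so some color shows up over
    at most [|V| * b / r <= |V| / k] vertices.  The complement of these vertices
    is large, hence contains an edge of [E], and all the copies of that edge miss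
    the color.  Cutting each blown-up edge, of size [N * b], down to [n] vertices
    gives [p(n, r) <= p'(N, k)] as soon as [n <= N * (r %/ k)]
    ([p_min_le_p'_min]).  The first assertion is the case
    [N = ceil(n / (r - k + 1)) * k], because [r - k + 1 <= k * (r %/ k)].

    For the second assertion, [p'(N, k)] is bounded on a vertex set of size
    [k * u].  Each set of [(k - 1) * u] vertices contains a proportion [q] of all
    [N]-sets, so picking [N]-sets greedily hits all [C(k * u, u)] such sets after
    about [ln C(k * u, u) / q] choices ([greedy_cover], [p'_min_le_greedy]).
    Here [ln C(k * u, u) <= u * (1 + ln k)], and [1 / q] is
    [exp (N / k + O(1))] once [u] has order [(N / k)^2] and [N / k = O(k)]; this
    is [p'_min_le_exp].

    Put [t = n / r], so that [t < r].  It remains to find [k] and [N] for which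
    [N / k] exceeds [t] by a bounded amount while [ln k = O(ln t)].
    - If [t^2 >= r], take [k = r] and [N = n]: there is no rounding loss, and
      [ln r <= 2 * ln t].
    - If [t^2 < r], take [k] about [t] and [N = ceil(n / (r %/ k))].  Rounding
      [r / k] down costs about [t * k / r = O(1)] in [N / k].
    When [t < 2] the logarithm may vanish or be negative, and the complete
    6-uniform hypergraph on 12 vertices gives a constant bound. *)

Import Order.TTheory GRing.Theory Num.Theory.
Local Open Scope ring_scope.

(** * Blowing up vertices *)

Lemma exists_subset_card (T : finType) (A : {set T}) (m : nat) :
  (m <= #|A|)%N -> exists2 B : {set T}, B \subset A & #|B| = m.
Proof.
rewrite -bin_gt0 -cards_draws => /card_gt0P[B].
by rewrite inE => /andP[sBA /eqP cB]; exists B.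
Qed.

(** Double counting: a vertex of [V] has [b] copies, so it contributes to at most
    [b] of the [r] colors; the average over the colors is at most
    [|V| * b / r <= |V| / k]. *)
Lemma rare_color (V : finType) (b k r : nat) (f : V * 'I_b -> 'I_r) :
  (0 < r)%N -> (k * b <= r)%N ->
  exists c : 'I_r, (#|[set v | [exists i, f (v, i) == c]]| * k <= #|V|)%N.
Proof.
move=> r_gt0 kb_le_r; apply/existsP; apply: contraTT isT.
rewrite negb_exists => /forallP many.
pose S c := [set v | [exists i, f (v, i) == c]].
have sumS : (\sum_c #|S c| <= #|V| * b)%N.
  rewrite (_ : (#|V| * b)%N = \sum_c #|[set x | f x == c]|)%N; last first.
    rewrite -[b in LHS]card_ord -card_prod -sum1_card.
    rewrite (partition_big f xpredT) //=; apply: eq_bigr => c _.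
    by rewrite -sum1dep_card.
  apply: leq_sum => c _.
  have -> : S c = [set x.1 | x in [set x | f x == c]].
    apply/setP => v; rewrite inE; apply/existsP/imsetP => [[i fvi]|].
      by exists (v, i); rewrite ?inE.
    by case=> -[w i]; rewrite inE => fwi /= ->; exists i.
  exact: leq_imset_card.
have : (\sum_(c < r) #|V|.+1 <= (\sum_c #|S c|) * k)%N.
  by rewrite big_distrl; apply: leq_sum => c _; rewrite ltnNge many.
rewrite sum_nat_const card_ord => low.
have : (r * #|V|.+1 <= #|V| * (k * b))%N.
  by apply: leq_trans low _; rewrite [(k * b)%N]mulnC mulnA leq_mul2r sumS orbT.
have : (#|V| * (k * b) <= #|V| * r)%N by rewrite leq_mul2l kb_le_r orbT.
by move=> h1 h2; have := leq_trans h2 h1; rewrite mulnS; lia.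
Qed.

(** The vertices over which the rare color never shows form a large set, so some
    edge of [E] has no copy of that color, and neither has the edge of [E'] chosen
    among its copies. *)
Lemma blowup_not_panchromatic (V : finType) (E : {set {set V}}) (b k r : nat)
    (E' : {set {set V * 'I_b}}) :
  (0 < k)%N -> (0 < r)%N -> (k * b <= r)%N -> large_sets_contain_edge k E ->
  (forall e, e \in E -> exists2 e', e' \in E' & e' \subset setX e setT) ->
  ~ (exists f : V * 'I_b -> 'I_r, panchromatic E' f).
Proof.
move=> k_gt0 r_gt0 kb_le_r largeE coverE [f panf].
have [c rare] := rare_color V b k r f r_gt0 kb_le_r.
set S := [set v | _] in rare.
have [|e eE eS] := largeE (~: S).
  rewrite ceil_div_leq // cardsCs setCK !mulnBl mul1n [(k * _)%N]mulnC.
  by rewrite leq_sub2l.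
have [e' e'E' e'e] := coverE e eE.
have [[v i] ve' fvi] := panf e' e'E' c.
have ve : v \in e by have := subsetP e'e _ ve'; rewrite !inE andbT.
have := subsetP eS v ve.
by rewrite !inE => /existsP[]; exists i; apply/eqP.
Qed.

(** The condition [n <= N * (r %/ k)] says that a blown-up edge has at least
    [n] vertices, so that it can be cut down to exactly [n]. *)
Lemma p_min_le_p'_min (R : realType) (n r N k : nat) :
  (0 < k)%N -> (0 < r)%N -> (n <= N * (r %/ k))%N ->
  (p_min R n r <= p'_min R N k)%E.
Proof.
move=> k_gt0 r_gt0 n_le; apply: le_ereal_inf_tmp => _ [V [E [uniE largeE ->]]].
set b := (r %/ k)%N in n_le.
have trim (e : {set V}) : e \in E ->
    exists e' : {set V * 'I_b}, (e' \subset setX e setT) && (#|e'| == n).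
  move=> eE; have [|e' e'e ce'] := @exists_subset_card _ (setX e [set: 'I_b]) n.
    by rewrite cardsX cardsT card_ord (uniE _ eE).
  by exists e'; rewrite e'e ce' eqxx.
pose t (e : {set V}) := odflt set0
  [pick e' : {set V * 'I_b} | (e' \subset setX e setT) && (#|e'| == n)].
have tP e : e \in E -> (t e \subset setX e setT) && (#|t e| == n).
  move=> eE; rewrite /t; case: pickP => [//|none].
  by have [e' e'P] := trim e eE; rewrite none in e'P.
apply: (@le_trans _ _ (#|[set t e | e in E]|%:R%:E)); last first.
  by rewrite lee_fin ler_nat leq_imset_card.
apply: ereal_inf_lbound; exists (V * 'I_b)%type, [set t e | e in E]; split=> //.
  by move=> _ /imsetP[e eE ->]; have /andP[_ /eqP] := tP e eE.
apply: (blowup_not_panchromatic V E b k r) => // [|e eE].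
  by rewrite mulnC leq_divM.
by exists (t e); [exact: imset_f | have /andP[] := tP e eE].
Qed.

(** * Greedy covering and binomial estimates *)

(** Greedy form of the random choice argument: since every [x] in [A] is related
    to a proportion at least [q] of [B], some [y] in [B] handles a proportion at
    least [q] of the elements still to be handled.  Each pick multiplies their
    number by at most [1 - q]. *)
Lemma greedy_cover (R : realType) (S T : finType) (h : S -> T -> bool)
    (A : {set S}) (B : {set T}) (q : R) (M : nat) :
  q <= 1 -> (0 < #|B|)%N ->
  (forall x, x \in A -> q * #|B|%:R <= #|[set y in B | h x y]|%:R) ->
  exists F : {set T}, [/\ F \subset B, (#|F| <= M)%N &
    #|[set x in A | [forall y in F, ~~ h x y]]|%:R <= (1 - q) ^+ M * #|A|%:R].
Proof.
move=> q_le1 B_gt0 degA.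
elim: M => [|M [F [FB cF missF]]].
  exists set0; rewrite sub0set cards0 expr0 mul1r; split=> //.
  by rewrite ler_nat subset_leq_card //; apply/subsetP => x; rewrite inE => /andP[].
set U := [set x in A | _] in missF.
(* Otherwise counting the related pairs of [U * B] along [B] contradicts [degA]. *)
have [y yB hy] : exists2 y, y \in B & q * #|U|%:R <= #|[set x in U | h x y]|%:R.
  apply/exists_inP; apply: contraT; rewrite negb_exists_in => /forall_inP few.
  have : \sum_(y in B) #|[set x in U | h x y]|%:R < \sum_(y in B) q * #|U|%:R :> R.
    have [y0 y0B] : exists y, y \in B by apply/card_gt0P.
    rewrite (bigD1 y0) //= [X in _ < X](bigD1 y0) //=; apply: ltr_leD.
      by rewrite ltNge few.
    by apply: ler_sum => y /andP[yB _]; apply: ltW; rewrite ltNge few.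
  rewrite sumr_const -natr_sum ltNge => /negP[].
  have -> : (\sum_(y in B) #|[set x in U | h x y]| =
      \sum_(x in U) #|[set y in B | h x y]|)%N.
    under eq_bigr do rewrite -sum1dep_card big_mkcondr.
    rewrite exchange_big; apply: eq_bigr => x _.
    by rewrite -sum1dep_card big_mkcondr.
  rewrite natr_sum -[leLHS]mulr_natr mulrAC [leLHS]mulr_natr -sumr_const.
  by apply: ler_sum => x; rewrite inE => /andP[xA _]; exact: degA.
exists (y |: F); split; first by rewrite subUset sub1set yB.
  by rewrite cardsU1; case: (y \notin F) => //=; rewrite leqW.
rewrite exprS -mulrA.
apply: le_trans (_ : (1 - q) * #|U|%:R <= _); last by rewrite ler_wpM2l // subr_ge0.
rewrite mulrBl mul1r lerBrDl; apply: le_trans (lerD hy (lexx _)) _.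
rewrite -natrD ler_nat -[leqRHS](cardsID [set x | h x y] U).
apply: leq_add; apply: subset_leq_card; apply/subsetP => x.
  by rewrite !inE => /andP[-> ->].
rewrite !inE => /andP[-> /forall_inP none] /=.
rewrite (none y) ?setU11 //=; apply/forall_inP => z zF.
by apply: none; rewrite setU1r.
Qed.

(** The term of index [u] in the expansion of [(1 + 1/k)^(k * u) <= e^u] is
    [C(k * u, u) / k^u]; the right-hand side is [(e * k)^u]. *)
Lemma bin_block_le (R : realType) (k u : nat) : (0 < k)%N ->
  ('C(k * u, u)%:R : R) <= expR (u%:R * (1 + ln k%:R)).
Proof.
move=> k_gt0; have kR : (0 : R) < k%:R by rewrite ltr0n.
have low : ('C(k * u, u)%:R : R) * k%:R^-1 ^+ u <= (1 + k%:R^-1) ^+ (k * u).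
  have u_lt : (u < (k * u).+1)%N by rewrite ltnS leq_pmull.
  rewrite exprDn (bigD1 (Ordinal u_lt)) //= expr1n mul1r mulr_natl lerDl.
  apply: sumr_ge0 => i _; apply: mulrn_wge0.
  by rewrite mulr_ge0 // exprn_ge0 // invr_ge0 ltW.
have high : (1 + (k%:R : R)^-1) ^+ (k * u) <= expR u%:R.
  apply: le_trans (_ : expR (k%:R^-1) ^+ (k * u) <= _).
    by apply: lerXn2r; rewrite ?nnegrE ?expR_ge0 ?expR_ge1Dx //.
  by rewrite -expRM_natl natrM mulrAC mulfV ?gt_eqF // mul1r.
have := le_trans low high.
rewrite exprVn ler_pdivrMr ?exprn_gt0 // => /le_trans; apply.
by rewrite mulrDr mulr1 expRD expRM_natl lnK // posrE.
Qed.

(** Factor by factor, [(w + u - i) / (w - i) = 1 + u / (w - i) <= 1 + d <= e^d]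
    for all [i < N]. *)
Lemma ffact_ratio_le (R : realType) (w u N : nat) (d : R) :
  (N <= w)%N -> 0 <= d -> u%:R <= d * (w - N)%:R ->
  ((w + u) ^_ N)%:R <= expR (N%:R * d) * (w ^_ N)%:R.
Proof.
elim: N => [|N IH] Nw d_ge0 hd; first by rewrite !ffactn0 mul0r expR0 mul1r.
have wN_gt0 : (0 : R) < (w - N)%:R by rewrite ltr0n subn_gt0.
have hdN : u%:R <= d * (w - N)%:R.
  by apply: le_trans hd _; rewrite ler_wpM2l // ler_nat leq_sub2l.
rewrite !ffactnSr !natrM -natr1 mulrDl mul1r expRD.
rewrite [X in _ <= X]mulrACA; apply: ler_pM => //; first exact: IH (ltnW Nw) d_ge0 hdN.
rewrite -addnBAC 1?ltnW // natrD.
apply: le_trans (_ : (1 + d) * (w - N)%:R <= _).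
  by rewrite mulrDl mul1r lerD2l.
by rewrite ler_pM2r // expR_ge1Dx.
Qed.

(** * Upper bounds for p' *)

Lemma large_sets_contain_edge_exact (V : finType) (E : {set {set V}}) (k u : nat) :
  (0 < k)%N -> #|V| = (k * u)%N ->
  (forall W : {set V}, #|W| = (k.-1 * u)%N -> exists2 e, e \in E & e \subset W) ->
  large_sets_contain_edge k E.
Proof.
move=> k_gt0 cV hitE W; rewrite ceil_div_leq // cV mulnCA mulnC leq_pmul2r // subn1.
move=> /exists_subset_card[W' sW'W /hitE[e eE sew]].
by exists e => //; apply: subset_trans sew sW'W.
Qed.

Lemma p'_min_le_bin (R : realType) (N : nat) :
  (p'_min R N 2 <= ('C(2 * N, N)%:R)%:E)%E.
Proof.
apply: ereal_inf_lbound; exists 'I_(2 * N), [set e : {set 'I_(2 * N)} | #|e| == N].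
split; first by move=> e; rewrite inE => /eqP.
  apply: (@large_sets_contain_edge_exact _ _ 2 N) => //; first by rewrite card_ord.
  by rewrite mul1n => W cW; exists W; rewrite ?inE ?cW.
by rewrite card_draws card_ord.
Qed.

(** [q] bounds below the proportion of [N]-sets inside a given set of
    [(k - 1) * u] vertices.  After [M > u * (1 + ln k) / q] greedy picks, fewer than
    one, hence none, of the [C(k * u, u) <= e^(u * (1 + ln k))] sets of this size
    fails to contain a picked edge. *)
Lemma p'_min_le_greedy (R : realType) (N k u : nat) (q : R) :
  (0 < k)%N -> (N <= k.-1 * u)%N -> 0 < q -> q <= 1 ->
  q * 'C(k * u, N)%:R <= 'C(k.-1 * u, N)%:R ->
  (p'_min R N k <= (u%:R * (1 + ln k%:R) / q + 1)%:E)%E.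
Proof.
move=> k_gt0 N_le q_gt0 q_le1 hq; set L := u%:R * _.
have L_ge0 : 0 <= L by rewrite mulr_ge0 // addr_ge0 // ln_ge0 // ler1n.
have ku : (k * u = k.-1 * u + u)%N by rewrite -{1}(prednK k_gt0) mulSn addnC.
set V := 'I_(k * u); pose B := [set e : {set V} | #|e| == N].
pose A := [set W : {set V} | #|W| == (k.-1 * u)%N].
pose h (W e : {set V}) := e \subset W.
have cB : #|B| = 'C(k * u, N) by rewrite card_draws card_ord.
have cA : #|A| = 'C(k * u, u).
  by rewrite card_draws card_ord ku -bin_sub ?leq_addr // addKn.
have degA W : W \in A -> q * #|B|%:R <= #|[set e in B | h W e]|%:R.
  rewrite inE => /eqP cW; apply: le_trans (_ : 'C(#|W|, N)%:R <= _).
    by rewrite cB cW.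
  rewrite ler_nat -cards_draws subset_leq_card //.
  by apply/subsetP => e; rewrite !inE andbC.
have B_gt0 : (0 < #|B|)%N by rewrite cB bin_gt0 ku (leq_trans N_le) ?leq_addr.
pose M := (Num.truncn (L / q)).+1.
have ltM : L < q * M%:R by rewrite mulrC -ltr_pdivrMr // truncnS_gt.
have leM : M%:R <= L / q + 1.
  have /truncn_itv/andP[lo _] : 0 <= L / q by rewrite divr_ge0 // ltW.
  by rewrite -natr1 lerD2r.
have [F [FB cF missF]] := @greedy_cover R _ _ h A B q M q_le1 B_gt0 degA.
have lt1 : (1 - q) ^+ M * #|A|%:R < 1.
  apply: le_lt_trans (_ : expR (- q) ^+ M * expR L < 1).
    apply: ler_pM; rewrite ?exprn_ge0 ?subr_ge0 //.
      by apply: lerXn2r; rewrite ?nnegrE ?subr_ge0 ?expR_ge0 ?expR_ge1Dx.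
    by rewrite cA bin_block_le.
  by rewrite -expRM_natl -expRD expR_lt1 mulrN addrC subr_lt0 mulrC.
have hitF (W : {set V}) : #|W| = (k.-1 * u)%N -> exists2 e, e \in F & e \subset W.
  move=> cW; apply/exists_inP; apply: contraT; rewrite negb_exists_in => WF.
  have : (0 < #|[set W in A | [forall e in F, ~~ h W e]]|)%N.
    by apply/card_gt0P; exists W; rewrite !inE cW eqxx.
  rewrite lt0n -leqn0 -ltnS -(ltr_nat R) => /negP[]; exact: le_lt_trans missF lt1.
apply: le_trans (_ : (#|F|%:R%:E <= _)%E); last first.
  by rewrite lee_fin (le_trans _ leM) // ler_nat.
apply: ereal_inf_lbound; exists V, F; split => //.
  by move=> e /(subsetP FB); rewrite inE => /eqP.
by apply: (@large_sets_contain_edge_exact _ _ k u) => //; rewrite card_ord.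
Qed.

(** The number [a] is an integer upper bound for [N / k].  With [u = 4 * a^2] and
    [w = (k - 1) * u], the proportion of [N]-sets inside a [w]-set is at least
    [exp (- N * u / (w - N))].  This exponent exceeds [N / k] by about
    [(N / k) / k + (N / k)^2 / u] up to constants, and both terms are bounded:
    the first by [a <= 4 * k], the second by the choice of [u]. *)
Lemma p'_min_le_exp (R : realType) (N k a : nat) :
  (2 < k)%N -> (1 < a)%N -> (a <= 4 * k)%N -> (N <= a * k)%N ->
  (p'_min R N k <= (4 * a%:R ^+ 2 * (1 + ln k%:R) * expR (N%:R / k%:R + 8) + 1)%:E)%E.
Proof.
move=> k_gt2 a_gt1 a_le N_le; have k_gt0 : (0 < k)%N by lia.
pose u := (4 * (a * a))%N; pose w := (k.-1 * u)%N.
have ku : (k * u = w + u)%N by rewrite -{1}(prednK k_gt0) mulSn addnC.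
have N_lt : (N < w)%N.
  apply: leq_ltn_trans N_le _; rewrite /w /u.
  have h : (k.+1 <= 2 * k.-1)%N by lia.
  have h2 : (a * k.+1 <= a * (2 * k.-1))%N by rewrite leq_mul2l h orbT.
  have h3 : (a * (2 * k.-1) <= k.-1 * (4 * (a * a)))%N by nia.
  by nia.
have kR : (3 : R) <= k%:R by rewrite ler_nat.
have aR : (2 : R) <= a%:R by rewrite ler_nat.
have akR : (a%:R : R) <= 4 * k%:R by rewrite -natrM ler_nat.
have NR : (N%:R : R) <= a%:R * k%:R by rewrite -natrM ler_nat.
have N0 : (0 : R) <= N%:R by [].
have uR : u%:R = 4 * a%:R ^+ 2 :> R by rewrite /u !natrM expr2.
have wNR : (w - N)%:R = (k%:R - 1) * u%:R - N%:R :> R.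
  by rewrite natrB 1?ltnW // /w natrM -subn1 natrB.
have wN_gt0 : 0 < (w - N)%:R :> R by rewrite ltr0n subn_gt0.
set d := u%:R / (w - N)%:R : R.
have d_ge0 : 0 <= d by rewrite divr_ge0.
have Nd : N%:R * d <= N%:R / k%:R + 8.
  rewrite /d mulrA ler_pdivrMr // wNR uR.
  set K := k%:R in kR akR NR *; set A := a%:R in aR akR NR *.
  have K0 : K != 0 by rewrite gt_eqF //; lra.
  have [x Nx] : exists x, N%:R = x * K by exists (N%:R / K); rewrite divfK.
  have Kgt0 : 0 < K by lra.
  have x_ge0 : 0 <= x by rewrite -(pmulr_lge0 _ Kgt0) -Nx.
  have x_le : x <= A by rewrite -(ler_pM2r Kgt0) -Nx.
  rewrite Nx mulfK //.
  (* The left-over terms [4 * A^2 * x + x^2 * K + 8 * x * K] are at most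
     [21 * A^2 * K], against the gain [32 * (K - 1) * A^2 >= 64/3 * A^2 * K]. *)
  have A2 : 0 <= A ^+ 2 by rewrite exprn_ge0.
  have h1 : 64 * (K * A ^+ 2) <= 96 * ((K - 1) * A ^+ 2).
    by nra.
  have h2 : A ^+ 2 * x <= A ^+ 2 * (4 * K).
    by apply: ler_wpM2l => //; lra.
  have h3 : x ^+ 2 * K <= A ^+ 2 * K.
    by rewrite ler_pM2r // lerXn2r ?nnegrE //; lra.
  have h4 : 2 * (x * K) <= A ^+ 2 * K.
    by rewrite mulrA ler_pM2r // expr2; nra.
  by lra.
set q := expR (- (N%:R / k%:R + 8)) : R.
have q_gt0 : 0 < q by exact: expR_gt0.
have q_le1 : q <= 1.
  by rewrite -expR0 ler_expR oppr_le0 addr_ge0 ?divr_ge0.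
have hq : q * 'C(k * u, N)%:R <= 'C(w, N)%:R.
  have Nf : (0 : R) < N`!%:R by rewrite ltr0n fact_gt0.
  rewrite -(ler_pM2r Nf) -mulrA -!natrM !bin_ffact ku /q expRN.
  rewrite mulrC ler_pdivrMr ?expR_gt0 // mulrC.
  apply: le_trans (ffact_ratio_le R w u N d (ltnW N_lt) d_ge0 _) _.
    by rewrite /d divfK // gt_eqF.
  by rewrite ler_wpM2r // ler_expR.
have := p'_min_le_greedy R N k u q k_gt0 (ltnW N_lt) q_gt0 q_le1 hq.
by rewrite /q expRN invrK uR.
Qed.

(** * Choosing the parameters *)

Lemma ceil_div_bounds (R : realType) (n d : nat) : (0 < d)%N ->
  (n%:R / d%:R <= (ceil_div n d)%:R :> R) &&
  ((ceil_div n d)%:R < n%:R / d%:R + 1 :> R).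
Proof.
move=> d_gt0; have dR : (0 : R) < d%:R by rewrite ltr0n.
rewrite ler_pdivrMr // -natrM ler_nat -ceil_div_leq // leqnn /=.
have [->|c_gt0] := posnP (ceil_div n d); first by rewrite ltr_wpDl ?divr_ge0.
rewrite -ltrBlDr -(natrB _ c_gt0) ltr_pdivlMr // -natrM ltr_nat.
by rewrite ltnNge -ceil_div_leq // -ltnNge subn1 prednK.
Qed.

(** The condition [N / k <= t + 7] keeps [e^(N / k)] within a constant factor of
    [e^t], the condition [k <= t^2] turns [ln k] into [O(ln t)], and [t <= k]
    gives [N / k = O(k)], which the bound for [p'] requires. *)
Lemma blowup_parameters (R : realType) (n r : nat) (t := n%:R / r%:R : R) :
  (2 * r <= n)%N -> (n < r ^ 2)%N ->
  exists k N : nat, [/\ (2 < k <= r)%N, (n <= N * (r %/ k))%N,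
    N%:R / k%:R <= t + 7, t <= k%:R & k%:R <= t ^+ 2].
Proof.
move=> n_ge n_lt.
have r_gt2 : (2 < r)%N by rewrite -(ltn_pmul2r (_ : 0 < r)%N); nia.
have rR : (0 : R) < r%:R by rewrite ltr0n; lia.
have tr : n%:R = t * r%:R by rewrite divfK // gt_eqF.
have t_ge2 : 2 <= t by rewrite ler_pdivlMr // -natrM ler_nat.
have [n_big|n_small] := leqP (r ^ 3)%N (n ^ 2)%N.
  exists r, n; rewrite r_gt2 leqnn divnn (ltn_trans _ r_gt2) // muln1; split=> //.
  - by rewrite -/t; lra.
  - by rewrite ler_pdivrMr // -natrM ler_nat ltnW.
  - by rewrite expr_div_n ler_pdivlMr ?exprn_gt0 // -exprS -!natrX ler_nat.
have t2_lt : t ^+ 2 < r%:R.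
  by rewrite expr_div_n ltr_pdivrMr ?exprn_gt0 // -exprS -!natrX ltr_nat.
have r_gt0 : (0 < r)%N by lia.
(* Here [k] is the integer [a + 1], about [t]: then [r - a >= r / 4]. *)
pose a := ceil_div n r.
have /andP[t_le a_lt] := ceil_div_bounds R n r r_gt0.
rewrite -/t -/a in t_le a_lt.
have a_lt_r : (a < r)%N by rewrite -(ltr_nat R); nra.
pose b := (r %/ a.+1)%N; pose N := ceil_div n b.
have b_gt0 : (0 < b)%N by rewrite divn_gt0.
exists a.+1, N; split.
- by rewrite a_lt_r andbT ltnS -(ler_nat R); lra.
- by rewrite -ceil_div_leq.
- have X_ge : (r%:R : R) - a%:R <= b%:R * a.+1%:R.
    rewrite -natrM -natrB 1?ltnW // ler_nat /b.
    by have := divn_eq r a.+1; have := ltn_pmod r (ltn0Sn a); lia.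
  have bR : (0 : R) < b%:R by rewrite ltr0n.
  have NbR : (N%:R : R) * b%:R <= t * r%:R + b%:R.
    have /andP[_ /ltW] := ceil_div_bounds R n b b_gt0.
    by rewrite -(ler_pM2r bR) mulrDl mul1r divfK ?gt_eqF // tr.
  have kR : (1 : R) <= a.+1%:R by rewrite ler1n.
  have n_le : t * r%:R <= (t + 6) * (b%:R * a.+1%:R).
    apply: le_trans (_ : (t + 6) * (r%:R - a%:R) <= _); last first.
      by rewrite ler_wpM2l //; lra.
    by nra.
  rewrite ler_pdivrMr ?ltr0n // -(ler_pM2r bR).
  by nra.
- by rewrite -natr1; lra.
- by rewrite -natr1; nra.
Qed.

Lemma p_min_le_exp (R : realType) (n r : nat) (t := n%:R / r%:R : R) :
  (2 * r <= n)%N -> (n < r ^ 2)%N ->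
  (p_min R n r <=
     ((400 * expR 15 + 1) * t ^+ 2 * ln t * expR t)%:E)%E.
Proof.
move=> n_ge n_lt.
have r_gt0 : (0 < r)%N by case: r n_lt {t n_ge}.
have rR : (0 : R) < r%:R by rewrite ltr0n.
have t_ge2 : 2 <= t by rewrite ler_pdivlMr // -natrM ler_nat.
have [k [N [/andP[k_gt2 k_le] n_le Nk tk kt]]] := blowup_parameters R n r n_ge n_lt.
rewrite -/t in Nk tk kt.
apply: le_trans (p_min_le_p'_min R n r N k _ r_gt0 n_le) _; first by lia.
(* An integer above [t + 7], hence above [N / k]. *)
pose a := (ceil_div n r + 7)%N.
have /andP[a0_ge a0_lt] := ceil_div_bounds R n r r_gt0.
rewrite -/t in a0_ge a0_lt.
have aE : a%:R = (ceil_div n r)%:R + 7 :> R by rewrite natrD.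
have kR : (3 : R) <= k%:R by rewrite ler_nat.
have k0 : (0 : R) < k%:R by lra.
have a_gt1 : (1 < a)%N by rewrite /a addnC.
have a_le : (a <= 4 * k)%N by rewrite -(ler_nat R) natrM; lra.
have N_le : (N <= a * k)%N.
  by rewrite -(ler_nat R) natrM -ler_pdivrMr //; lra.
apply: le_trans (p'_min_le_exp R N k a k_gt2 a_gt1 a_le N_le) _.
rewrite lee_fin.
(* From [ln (1/t) <= 1/t - 1 <= -1/2]. *)
have ln_t : 1 <= 2 * ln t.
  have : ln (1 + (t^-1 - 1)) <= t^-1 - 1.
    by apply: le_ln1Dx; have : 0 < t^-1 by [rewrite invr_gt0; lra]; lra.
  rewrite addrC subrK lnV ?posrE; last by lra.
  have : t^-1 <= 2^-1 by rewrite lef_pV2 ?posrE //; lra.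
  by lra.
have ln_k : 1 + ln k%:R <= 4 * ln t.
  have : ln k%:R <= ln (t ^+ 2) by rewrite ler_ln ?posrE ?exprn_gt0 //; lra.
  rewrite lnXn; last by lra.
  by rewrite mulr2n; lra.
have ln_k0 : 0 <= 1 + ln (k%:R : R) by rewrite addr_ge0 // ln_ge0; lra.
have a2 : a%:R ^+ 2 <= 25 * t ^+ 2 by nra.
have e_le : expR (N%:R / k%:R + 8) <= expR t * expR 15.
  by rewrite -expRD ler_expR; lra.
have et : 1 <= expR t by rewrite -expR0 ler_expR; lra.
have t2 : 4 <= t ^+ 2 by nra.
have main : 4 * a%:R ^+ 2 * (1 + ln k%:R) * expR (N%:R / k%:R + 8)
    <= 4 * (25 * t ^+ 2) * (4 * ln t) * (expR t * expR 15).
  apply: ler_pM; rewrite ?mulr_ge0 ?expR_ge0 //.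
  apply: ler_pM => //.
  by rewrite ler_pM2l.
have one : 1 <= t ^+ 2 * ln t * expR t.
  apply: le_trans (_ : t ^+ 2 * ln t <= _); first by nra.
  by rewrite ler_peMr // mulr_ge0; lra.
apply: le_trans (lerD main one) _.
by rewrite le_eqVlt; apply/orP; left; apply/eqP; ring.
Qed.

(** Here [6 * (r %/ 2) >= 3 * (r - 1) >= 2 * r - 1 >= n], and [924 = C(12, 6)]. *)
Lemma p_min_le_const (R : realType) (n r : nat) :
  (1 < r)%N -> (n < 2 * r)%N -> (p_min R n r <= 924%:R%:E)%E.
Proof.
move=> r_gt1 n_lt.
apply: le_trans (p_min_le_p'_min R n r 6 2 isT (ltnW r_gt1) _) _; first by lia.
by apply: le_trans (p'_min_le_bin R 6) _; rewrite lee_fin ler_nat.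
Qed.

Theorem corollary1p7 (R : realType) :
  (forall n r k : nat, (0 < n)%N -> (0 < r)%N -> (0 < k)%N -> (k <= r)%N ->
     (p_min R n r <= p'_min R (ceil_div n (r - k + 1) * k) k)%E)
  /\
  (exists c : R, 0 < c /\
     forall n r : nat, (0 < n)%N -> (0 < r)%N -> (n < r ^ 2)%N ->
       ((2 * r <= n)%N ->
          (p_min R n r <= (c * (n%:R / r%:R) ^+ 2 * ln (n%:R / r%:R)
                             * expR (n%:R / r%:R))%:E)%E)
       /\ ((n < 2 * r)%N -> (p_min R n r <= c%:E)%E)).
Proof.
split=> [n r k n_gt0 r_gt0 k_gt0 k_le|].
  apply: p_min_le_p'_min => //; rewrite -mulnA.
  apply: leq_trans (_ : ceil_div n (r - k + 1) * (r - k + 1) <= _)%N.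
    by rewrite -ceil_div_leq // addn1.
  rewrite leq_mul2l; apply/orP; right.
  by have := divn_eq r k; have := ltn_pmod r k_gt0; lia.
have e15 : 0 < expR (15 : R) by exact: expR_gt0.
exists (400 * expR 15 + 924); split; first by lra.
move=> n r n_gt0 r_gt0 n_lt.
split=> [n_ge|n_lt2].
  apply: le_trans (p_min_le_exp R n r n_ge n_lt) _; rewrite lee_fin.
  have t_ge1 : 1 <= n%:R / r%:R :> R.
    by rewrite ler_pdivlMr ?ltr0n // mul1r ler_nat; lia.
  apply: ler_wpM2r; first exact: expR_ge0.
  apply: ler_wpM2r; first exact: ln_ge0.
  apply: ler_wpM2r; first by rewrite exprn_ge0 // divr_ge0.
  by lra.
have r_gt1 : (1 < r)%N by nia.
apply: le_trans (p_min_le_const R n r r_gt1 n_lt2) _; rewrite lee_fin.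
by lra.
Qed.
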